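(* For any graph $G$, $\mathrm{fdim}(G)\le 2\cdot\chi(G)-1$, where $\chi(G)$ is the chromatic number of $G$.
   Context: $\mathbb{N}=\{0,1,2,\dots\}$. Graphs are finite and simple, i.e. undirected, without loops or multiple edges. A polytope $P\subset\mathbb{Q}^d$ is a lattice polytope if all its vertices are in $\mathbb{Z}^d$. A finite set $\mathcal{M}\subset\mathbb{Z}^d\setminus\{0\}$ is a set of moves if $\mathcal{M}=-\mathcal{M}$ and if for all $\lambda\in\mathbb{N}$ with $\lambda\ge 2$ and all $m\in\mathcal{M}$, $\lambda\cdot m\notin\mathcal{M}$. For a lattice polytope $P\subset\mathbb{Q}^d$ and a set of moves $\mathcal{M}\subset\mathbb{Z}^d$, the fiber graph $P(\mathcal{M})$ is the graph with node set $P\cap\mathbb{Z}^d$ in which two nodes $u$ and $v$ are adjacent if $u-v\in\mathcal{M}$. The fiber dimension $\mathrm{fdim}(G)$ of a graph $G$ is the smallest $d\in\mathbb{N}$ such that there exist a full dimensional (i.e. $d$-dimensional) lattice polytope $P\subset\mathbb{Q}^d_{\ge 0}$ and a set of moves $\mathcal{M}\subset\mathbb{Z}^d$ with $G\cong P(\mathcal{M})$. *)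

(* Defs.v *)
From mathcomp Require Import all_boot all_order all_algebra.
From mathcomp Require Import finmap classical_sets functions.

Set Implicit Arguments.
Unset Strict Implicit.
Unset Printing Implicit Defensive.

Import Order.TTheory GRing.Theory Num.Theory.

Local Open Scope classical_set_scope.
Local Open Scope ring_scope.

Record sgraph := SGraph {
  node :> finType;
  edge : rel node;
  edge_sym : symmetric edge;
  edge_irrefl : irreflexive edge
}.

Definition colorable (G : sgraph) (k : nat) : bool :=
  [exists c : {ffun G -> 'I_k}, [forall x, forall y, edge x y ==> (c x != c y)]].

Lemma colorable_ex (G : sgraph) : exists k, colorable G k.
Proof.
exists #|G|; apply/existsP; exists [ffun x => enum_rank x].
apply/forallP=> x; apply/forallP=> y; apply/implyP=> xy.
by rewrite !ffunE (inj_eq enum_rank_inj); apply: contraTneq xy => ->;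
  rewrite edge_irrefl.
Qed.

Definition chromatic_number (G : sgraph) : nat := ex_minn (colorable_ex G).

Definition int_point d (u : 'rV[int]_d) : 'rV[rat]_d := map_mx intr u.

Definition affine_hull d (A : set 'rV[rat]_d) : set 'rV[rat]_d :=
  [set x | exists n (p : 'I_n -> 'rV[rat]_d) (w : 'I_n -> rat),
     [/\ forall i, A (p i), \sum_i w i = 1 & x = \sum_i w i *: p i]].

Definition convex_hull d (A : set 'rV[rat]_d) : set 'rV[rat]_d :=
  [set x | exists n (p : 'I_n -> 'rV[rat]_d) (w : 'I_n -> rat),
     [/\ forall i, A (p i), forall i, 0 <= w i, \sum_i w i = 1
       & x = \sum_i w i *: p i]].

Definition polytope d (P : set 'rV[rat]_d) : Prop :=
  exists s : seq 'rV[rat]_d, P = convex_hull [set` s].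

(* [v] is a 0-dimensional face: the unique maximizer on [P] of some linear
   functional. *)
Definition vertex d (P : set 'rV[rat]_d) (v : 'rV[rat]_d) : Prop :=
  P v /\ exists c : 'rV[rat]_d,
    forall x, P x -> x <> v -> \sum_i c 0 i * x 0 i < \sum_i c 0 i * v 0 i.

Definition lattice_polytope d (P : set 'rV[rat]_d) : Prop :=
  polytope P /\ forall v, vertex P v -> range (@int_point d) v.

(* The affine hull is a translate of a [k]-dimensional linear subspace; the
   empty set therefore has no dimension. *)
Definition has_dim d (P : set 'rV[rat]_d) (k : nat) : Prop :=
  exists (x0 : 'rV[rat]_d) (U : {vspace 'rV[rat]_d}),
    \dim U = k /\ affine_hull P = [set x | x - x0 \in U].

Definition full_dimensional d (P : set 'rV[rat]_d) : Prop := has_dim P d.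

Definition set_of_moves d (M : {fset 'rV[int]_d}) : Prop :=
  [/\ 0 \notin M,
      forall m, (- m \in M) = (m \in M)
    & forall (l : nat) m, (2 <= l)%N -> m \in M -> m *+ l \notin M].

Definition fiber_node d (P : set 'rV[rat]_d) : set 'rV[int]_d :=
  [set u | P (int_point u)].

Definition fiber_edge d (M : {fset 'rV[int]_d}) : rel 'rV[int]_d :=
  fun u v => u - v \in M.

Definition iso_fiber_graph (G : sgraph) d (P : set 'rV[rat]_d)
    (M : {fset 'rV[int]_d}) : Prop :=
  exists f : G -> 'rV[int]_d,
    set_bij [set: G] (fiber_node P) f /\
    forall x y, edge x y = fiber_edge M (f x) (f y).

Definition fiber_realizable (G : sgraph) (d : nat) : Prop :=
  exists (P : set 'rV[rat]_d) (M : {fset 'rV[int]_d}),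
    [/\ lattice_polytope P,
        full_dimensional P,
        forall x, P x -> forall i, 0 <= x 0 i,
        set_of_moves M
      & iso_fiber_graph G P M].

(* A relation rather than a function: [is_fdim G d] says that the minimum
   defining fdim(G) exists and equals [d]. *)
Definition is_fdim (G : sgraph) (d : nat) : Prop :=
  fiber_realizable G d /\ forall d', fiber_realizable G d' -> (d <= d')%N.

(* Main.v *)
Require Import Defs.
From mathcomp Require Import all_boot all_order all_algebra.
From mathcomp Require Import finmap classical_sets functions boolp.
From mathcomp Require Import zify ring.

Set Implicit Arguments.
Unset Strict Implicit.
Unset Printing Implicit Defensive.

Import Order.TTheory GRing.Theory Num.Theory.

Local Open Scope classical_set_scope.
Local Open Scope ring_scope.

(** Take a proper colouring with k = chi(G) colours, so that each colour is in
    use. Put the nodes of each colour class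
    on the consecutive lattice points of a segment, and let the k segments
    start at the k vertices of a unimodular (k-1)-simplex, each one running in
    a new coordinate direction. The convex hull P of all these points is the
    join (Cayley polytope) of the segments. Its dimension is k - 1 plus one for
    each colour class with at least two nodes, hence at most 2k - 1.

    The only lattice points of P are those placed there: the simplex
    coordinates of a lattice point of P are nonnegative integers with sum 1, so
    the point lies over a vertex of the simplex, that is, in one of the
    segments ([join_point_lattice]).

    Edges join different colours, and the difference of points x and y in two
    different segments determines both: its simplex coordinates tell which two
    segments, and the direction coordinates of these segments tell where on
    them x and y lie. The nonzero simplex coordinates are 1 and -1, so such a
    difference is moreover no proper multiple of another one
    ([join_point_diff]). Hence the differences along edges form a set of moves
    that creates no adjacency other than the edges of G.

    Such an embedding realizes G ([realizable_of_embedding]), and since some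
    realization exists, the least dimension of a realization is defined. *)

(** * Convex hulls of finitely many points *)

Lemma subset_convex_hull d (A : set 'rV[rat]_d) : A `<=` convex_hull A.
Proof.
move=> x Ax; exists 1%N, (fun=> x), (fun=> 1).
by split=> //; rewrite big_ord1 ?scale1r.
Qed.

(** A functional whose unique maximum on the hull is at v takes a smaller value
    at each other point of A, so a convex combination of points of A that are
    all different from v cannot reach the value at v. *)
Lemma vertex_convex_hull d (A : set 'rV[rat]_d) v :
  vertex (convex_hull A) v -> A v.
Proof.
move=> [[n [p [w [Ap w_ge0 w_sum1 vE]]]] [l lmax]].
pose L (x : 'rV[rat]_d) := \sum_i l 0 i * x 0 i.
have [[i pv]|pNv] := pselect (exists i, p i = v); first by rewrite -pv.
have Lp i : L (p i) < L v.
  by apply: lmax => [|piv]; [exact: subset_convex_hull | apply: pNv; exists i].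
have LvE : L v = \sum_i w i * L (p i).
  transitivity (\sum_j \sum_i w i * (l 0 j * p i 0 j)).
    apply: eq_bigr => j _; rewrite [in LHS]vE summxE mulr_sumr.
    by apply: eq_bigr => i _; rewrite mxE; ring.
  by rewrite exchange_big; apply: eq_bigr => i _; rewrite -mulr_sumr.
(* A sum of nonnegative terms that vanishes, so every weight is zero. *)
have gap0 : \sum_i w i * (L v - L (p i)) = 0.
  under eq_bigr do rewrite mulrBr.
  by rewrite sumrB -mulr_suml w_sum1 mul1r -LvE subrr.
have term_ge0 i : true -> 0 <= w i * (L v - L (p i)).
  by move=> _; rewrite mulr_ge0 // subr_ge0 ltW.
have w0 i : w i = 0.
  move: (@psumr_eq0P _ _ _ _ term_ge0 gap0 i isT) => /eqP.
  rewrite mulf_eq0 => /orP[/eqP //|].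
  by rewrite subr_eq0 eq_sym (lt_eqF (Lp i)).
by move: w_sum1; rewrite big1 => // /eqP; rewrite eq_sym oner_eq0.
Qed.

(** * Lattice embeddings that realize a graph *)

Section Realization.
Variables (G : sgraph) (d : nat) (f : G -> 'rV[int]_d) (r : G).

Definition node_hull : set 'rV[rat]_d :=
  convex_hull [set` [seq int_point (f u) | u <- enum G]].

Lemma node_hullP x : node_hull x ->
  exists n (u : 'I_n -> G) (w : 'I_n -> rat),
    [/\ forall i, 0 <= w i, \sum_i w i = 1 & x = \sum_i w i *: int_point (f (u i))].
Proof.
move=> [n [p [w [Ap w_ge0 w_sum1 ->]]]].
have /fin_all_exists[u pu] : forall i, exists u, p i = int_point (f u).
  by move=> i; have /mapP[u _ ->] := Ap i; exists u.
by exists n, u, w; split=> //; apply: eq_bigr => i _; rewrite pu.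
Qed.

Lemma node_in_hull u : node_hull (int_point (f u)).
Proof.
by apply: subset_convex_hull; apply/mapP; exists u; rewrite ?mem_enum.
Qed.

(** Every point x is f r plus a combination of unit vectors. Replacing each unit
    vector by a difference of two embedded nodes turns this into an affine
    combination of embedded nodes, because differences contribute total weight
    zero. *)
Lemma affine_node_hull : (forall j, exists u v, f u - f v = delta_mx 0 j) ->
  affine_hull node_hull = setT.
Proof.
move=> span; apply/seteqP; split=> // x _.
have /fin_all_exists[u /fin_all_exists[v uv]] := span.
pose y := x - int_point (f r).
pose W g : rat := (g == r)%:R + \sum_j y 0 j * ((g == u j)%:R - (g == v j)%:R).
have pick h (F : G -> 'rV[rat]_d) : \sum_g (g == h)%:R *: F g = F h.
  rewrite (bigD1 h) //= eqxx scale1r big1 ?addr0 // => g /negbTE->.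
  by rewrite scale0r.
have pick1 h : \sum_(g : G) (g == h)%:R = 1 :> rat.
  by rewrite (bigD1 h) //= eqxx big1 ?addr0 // => g /negbTE->.
exists #|G|, (fun i => int_point (f (enum_val i))), (fun i => W (enum_val i)).
split=> [i||]; first exact: node_in_hull.
  rewrite -(big_enum_val W) /= big_split /= pick1 exchange_big /= big1 ?addr0 // => j _.
  by rewrite -mulr_sumr sumrB !pick1 subrr mulr0.
rewrite -(big_enum_val (fun g => W g *: int_point (f g))) /=.
under eq_bigr do rewrite scalerDl scaler_suml.
rewrite big_split /= pick exchange_big /=.
under eq_bigr => j _.
  under eq_bigr do rewrite -scalerA scalerBl.
  rewrite -scaler_sumr sumrB !pick.
  have -> : int_point (f (u j)) - int_point (f (v j)) = delta_mx 0 j.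
    by rewrite /int_point -raddfB /= uv map_delta_mx.
  over.
by rewrite -row_sum_delta addrC subrK.
Qed.

(** The polytope is the hull of the embedded nodes, the moves are the
    differences along edges. The last hypothesis covers two needs: for l = 1 it
    forbids adjacencies that are not edges of G, and for l >= 2 it forbids a
    move that is a multiple of another move. *)
Lemma realizable_of_embedding :
  (forall u j, 0 <= f u 0 j) ->
  injective f ->
  (forall n (u : 'I_n -> G) (w : 'I_n -> rat) v, (forall i, 0 <= w i) ->
     \sum_i w i = 1 -> int_point v = \sum_i w i *: int_point (f (u i)) ->
     exists x, f x = v) ->
  (forall j, exists u v, f u - f v = delta_mx 0 j) ->
  (forall x y x' y' l, edge x y -> (0 < l)%N ->
     f x - f y = (f x' - f y') *+ l -> [/\ l = 1%N, x = x' & y = y']) ->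
  fiber_realizable G d.
Proof.
move=> f_ge0 f_inj lat span diff.
pose M := [fset z in [seq f p.1 - f p.2 | p <- enum {: G * G} & edge p.1 p.2]]%fset.
have MP z : reflect (exists x y, edge x y /\ z = f x - f y) (z \in M).
  rewrite in_fset; apply: (iffP mapP) => [[[x y]]|[x [y [xy ->]]]].
    by rewrite mem_filter /= => /andP[xy _] ->; exists x, y.
  by exists (x, y); rewrite // mem_filter mem_enum andbT.
exists node_hull, M; split.
- split; first by exists [seq int_point (f u) | u <- enum G].
  by move=> v /vertex_convex_hull /mapP[u _ ->]; exists (f u).
- exists 0, fullv; split; first by rewrite dimvf /dim /= mul1n.
  rewrite affine_node_hull //; apply/seteqP; split=> x //= _; exact: memvf.
- move=> x /node_hullP[n [u [w [w_ge0 _ ->]]]] i.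
  rewrite summxE sumr_ge0 // => j _; rewrite !mxE mulr_ge0 ?ler0z //.
- split.
  + apply/MP => -[x [y [xy /eqP]]]; rewrite eq_sym subr_eq0 => /eqP/f_inj xE.
    by move: xy; rewrite xE edge_irrefl.
  + move=> m; apply/MP/MP => -[x [y [xy mE]]]; exists y, x; rewrite edge_sym;
      split=> //; first by rewrite -[m]opprK mE opprB.
    by rewrite mE opprB.
  + move=> l m l2 /MP[x' [y' [_ ->]]]; apply/MP => -[x [y [xy E]]].
    have [l1 _ _] := diff _ _ _ _ _ xy (ltnW l2) (esym E).
    by rewrite l1 in l2.
- exists f; split.
    split=> [u _|u v _ _ /f_inj //|v /node_hullP[n [u [w [w0 w1 vE]]]]].
      exact: node_in_hull.
    by have [x <-] := lat _ _ _ _ w0 w1 vE; exists x.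
  move=> x y; rewrite /fiber_edge; apply/idP/MP => [xy|[x' [y' [xy' E]]]].
    by exists x, y.
  by have [_ <- <-] := diff _ _ _ _ _ xy' (ltn0Sn 0) (esym E).
Qed.

End Realization.

(** * The join of the colour classes *)

Section SegmentJoin.
Variables (G : sgraph) (k : nat) (c : G -> 'I_k).
Hypothesis c_proper : forall x y, edge x y -> c x != c y.

Definition color_class q : seq G := enum [pred x | c x == q].

Definition rank_in_class x := index x (color_class (c x)).

Local Notation a := rank_in_class.

Lemma mem_color_class q x : (x \in color_class q) = (c x == q).
Proof. by rewrite mem_enum inE. Qed.

Lemma rank_lt x : (a x < size (color_class (c x)))%N.
Proof. by rewrite index_mem mem_color_class. Qed.

Lemma rank_inj x y : c x = c y -> a x = a y -> x = y.
Proof.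
move=> cxy; rewrite /a cxy => axy.
by rewrite -(nth_index x (s := color_class (c y)) (x := x)) ?axy ?nth_index
  ?mem_color_class ?cxy.
Qed.

Lemma rank_surj x m : (m < size (color_class (c x)))%N ->
  exists2 y, c y = c x & a y = m.
Proof.
move=> m_lt; pose y := nth x (color_class (c x)) m.
have cy : c y = c x by apply/eqP; rewrite -mem_color_class mem_nth.
by exists y; rewrite // /a cy index_uniq ?enum_uniq.
Qed.

(** The root is the node placed at the origin, which is the vertex of the
    simplex that has no coordinate of its own. *)
Variable root : G.
Hypothesis root_rank : a root = 0%N.

(** One pivot per coordinate. A pivot of rank 0 stands for the simplex
    coordinate of its colour, a pivot of rank 1 for the direction of the segment
    of its colour; a class with a single node has no node of rank 1 and thus
    gets no direction. *)
Definition pivots : {set G} := [set x | (a x <= 1)%N && (x != root)].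

(** Since 0 ^ 0 = 1, this is the indicator of the colour of x when x has rank 0,
    and the rank of u in that colour class when x has rank 1. *)
Definition pivot_coord u x : nat := ((c u == c x) * a u ^ a x)%N.

Definition join_point u : 'rV[int]_#|pivots| :=
  \row_j (pivot_coord u (enum_val j))%:Z.

Local Notation f := join_point.

(** The root and the pivots are told apart by their colour and their rank, which
    is 0 or 1, so there are at most 2k of them together. *)
Lemma card_pivots : (#|pivots| < 2 * k)%N.
Proof.
have -> : #|pivots|.+1 = #|root |: pivots|.
  by rewrite cardsU1 inE eqxx andbF.
rewrite (@leq_trans #|{: 'I_k * bool}|) //; last first.
  by rewrite card_prod card_ord card_bool mulnC.
rewrite -(@card_in_imset _ _ (fun x => (c x, a x == 1%N))) ?max_card //.
have small x : x \in root |: pivots -> (a x <= 1)%N.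
  by rewrite !inE => /orP[/eqP->|/andP[]//]; rewrite root_rank.
move=> x y /small ax /small ay [cxy axy]; apply: rank_inj => //.
by move: (a x) (a y) ax ay axy => [|[|?]] [|[|?]].
Qed.

Lemma join_point_pivot x (xP : x \in pivots) u :
  f u 0 (enum_rank_in xP x) = (pivot_coord u x)%:Z.
Proof. by rewrite mxE enum_rankK_in. Qed.

(** Restriction to the nodes of an affine function with integer coefficients.
    Such a function is constrained by linear relations between differences of
    embedded nodes, and it is an integer at lattice points of their hull. It
    allows for treating the colour of the root, whose indicator is 1 minus the
    sum of the simplex coordinates, like the other colours. *)
Definition affine_on_nodes (g : G -> int) :=
  exists (l : 'rV[int]_#|pivots|) b, forall u, g u = \sum_j l 0 j * f u 0 j + b.

Lemma affine_on_nodes_sub g x y x' y' l : affine_on_nodes g ->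
  f x - f y = (f x' - f y') *+ l -> g x - g y = (g x' - g y') *+ l.
Proof.
move=> [h [b gE]] E.
have cancel_b (s t : int) : s + b - (t + b) = s - t by ring.
rewrite !gE !cancel_b -!sumrB -sumrMnl.
apply: eq_bigr => j _; move/rowP/(_ j): E.
by rewrite -!mulrBr -mulrnAr mulmxnE !mxE => ->.
Qed.

Lemma affine_on_nodes_int g n (u : 'I_n -> G) (w : 'I_n -> rat) v :
  affine_on_nodes g -> \sum_i w i = 1 ->
  int_point v = \sum_i w i *: int_point (f (u i)) ->
  exists m : int, \sum_i w i * (g (u i))%:~R = m%:~R.
Proof.
move=> [l [b gE]] w1 vE; exists (\sum_j l 0 j * v 0 j + b).
rewrite rmorphD rmorph_sum /=.
under eq_bigr do rewrite gE rmorphD rmorph_sum /= mulrDr mulr_sumr.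
rewrite big_split /= -mulr_suml w1 mul1r exchange_big; congr (_ + _).
apply: eq_bigr => j _ /=; rewrite rmorphM /=.
have -> : (v 0 j)%:~R = \sum_i w i * (f (u i) 0 j)%:~R :> rat.
  move/rowP/(_ j): vE; rewrite mxE summxE => ->.
  by apply: eq_bigr => i _; rewrite !mxE.
by rewrite mulr_sumr; apply: eq_bigr => i _; rewrite rmorphM /=; ring.
Qed.

(** If x is a pivot, this is a coordinate. If x is the root, it is 1 minus the
    sum of all simplex coordinates. *)
Lemma pivot_coord_affine x : (a x <= 1)%N ->
  affine_on_nodes (fun u => (pivot_coord u x)%:Z).
Proof.
move=> ax; have [->|xr] := eqVneq x root; last first.
  have xP : x \in pivots by rewrite inE ax.
  exists (delta_mx 0 (enum_rank_in xP x)), 0 => u.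
  rewrite addr0 (bigD1 (enum_rank_in xP x)) //= mxE !eqxx mul1r join_point_pivot.
  by rewrite big1 ?addr0 // => j jx; rewrite mxE (negbTE jx) andbF mul0r.
exists (\row_j - (a (enum_val j) == 0%N)%:Z), 1 => u.
have [h ch ah] : exists2 h, c h = c u & a h = 0%N.
  by apply: rank_surj; apply: leq_trans (rank_lt u).
(* Only the rank 0 node of the colour of u contributes. *)
have one : \sum_(y | a y == 0%N) (pivot_coord u y)%:Z = 1.
  rewrite (bigD1 h) ?ah //= big1 => [|y /andP[/eqP ay yh]].
    by rewrite /pivot_coord ch eqxx ah.
  rewrite /pivot_coord; case: eqP => // cuy.
  by case/eqP: yh; apply: rank_inj; rewrite ?ah // ch.
rewrite (bigD1 root) ?root_rank //= in one.
(* Writing the constant term 1 as that sum cancels the other coordinates. *)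
rewrite -{}one addrCA; apply/eqP; rewrite eq_sym -subr_eq0 addrAC subrr add0r.
rewrite [X in _ + X](_ : _ = \sum_(y in pivots) (a y == 0%N)%:Z * (pivot_coord u y)%:Z).
  rewrite [X in _ + X]big_enum_val -big_split big1 //= => j _; rewrite !mxE; lia.
rewrite [LHS]big_mkcond [RHS]big_mkcond; apply: eq_bigr => y _ /=.
by rewrite inE; case: (a y) => [|[|?]] //=; case: eqP => //=; lia.
Qed.

Lemma same_color_affine y : affine_on_nodes (fun u => (c u == c y)%:Z).
Proof.
have [h ch ah] : exists2 h, c h = c y & a h = 0%N.
  by apply: rank_surj; apply: leq_trans (rank_lt y).
have [|l [b gE]] := @pivot_coord_affine h; first by rewrite ah.
by exists l, b => u; rewrite -gE /pivot_coord ah ch muln1.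
Qed.

(** In a class with a single node this function is zero; otherwise it is the
    coordinate of the node of rank 1. *)
Lemma rank_affine y : affine_on_nodes (fun u => ((c u == c y) * a u)%N%:Z).
Proof.
have [small|big] := leqP (size (color_class (c y))) 1.
  exists 0, 0 => u; rewrite big1 => [|j _]; last by rewrite mxE mul0r.
  case: eqP => // cuy; have := rank_lt u; rewrite cuy.
  by case: (a u) => //= m; lia.
have [h ch ah] := rank_surj big.
have [|l [b gE]] := @pivot_coord_affine h; first by rewrite ah.
by exists l, b => u; rewrite -gE /pivot_coord ah ch.
Qed.

(** The colour indicators of c x and c y take the values 1 and -1 on the
    difference, which forces l = 1, c x' = c x and c y' = c y; the ranks are
    then read off from the directions of the two segments. *)
Lemma join_point_diff x y x' y' l : c x != c y -> (0 < l)%N ->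
  f x - f y = (f x' - f y') *+ l -> [/\ l = 1%N, x = x' & y = y'].
Proof.
move=> cxy l_gt0 E.
have same z := affine_on_nodes_sub (same_color_affine z) E.
have rank z := affine_on_nodes_sub (rank_affine z) E.
have := same x; rewrite eqxx [c y == _]eq_sym (negbTE cxy).
have := same y; rewrite eqxx (negbTE cxy).
have := rank x; rewrite eqxx [c y == _]eq_sym (negbTE cxy).
have := rank y; rewrite eqxx (negbTE cxy).
case: (c x' =P c x) => [x'x|_]; case: (c y' =P c y) => [y'y|_];
  try (case: eqP; case: eqP; lia).
rewrite x'x y'y (negbTE cxy) eq_sym (negbTE cxy) => ry rx _ l1.
have {}l1 : l = 1%N by lia.
by subst l; split=> //; apply: rank_inj; rewrite ?x'x ?y'y //; lia.
Qed.

Lemma join_point_inj : injective f.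
Proof.
move=> x y E.
have E' : f x - f y = (f x - f x) *+ 1 by rewrite E !subrr.
have := affine_on_nodes_sub (same_color_affine x) E'.
have := affine_on_nodes_sub (rank_affine x) E'.
rewrite !subrr !eqxx; case: (c y =P c x) => [cyx|_] //= ra _.
by apply: rank_inj; rewrite ?cyx //; lia.
Qed.

(** A pivot of rank 1 and the rank 0 node of its colour differ by the unit
    vector of that pivot. So do a pivot of rank 0 and the root, whose point is
    the origin. *)
Lemma join_point_span j : exists u v, f u - f v = delta_mx 0 j.
Proof.
set x := enum_val j.
have := enum_valP j; rewrite -/x inE => /andP[ax xr].
case ax1 : (a x == 1%N).
  have [h ch ah] : exists2 h, c h = c x & a h = 0%N.
    by apply: rank_surj; apply: leq_trans (rank_lt x).
  exists x, h; apply/rowP => i; rewrite !mxE eqxx /= /pivot_coord ch (eqP ax1) ah.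
  rewrite -(inj_eq enum_val_inj) -/x; set y := enum_val i.
  have : y \in pivots := enum_valP i; rewrite inE => /andP[ay _].
  case: (c x =P c y) => [cxy|cxy]; last by case: eqP => [yx|//]; rewrite yx in cxy.
  case ay1 : (a y == 1%N).
    have -> : y = x by apply: rank_inj; rewrite // (eqP ax1) (eqP ay1).
    by rewrite eqxx (eqP ax1).
  have -> : (y == x) = false by apply: contraFF ay1 => /eqP->.
  by have -> : a y = 0%N by lia.
have {ax ax1} ax : a x = 0%N by lia.
exists x, root; apply/rowP => i; rewrite !mxE eqxx /= /pivot_coord ax root_rank.
rewrite -(inj_eq enum_val_inj) -/x; set y := enum_val i.
have : y \in pivots := enum_valP i; rewrite inE => /andP[ay yr].
have cxr : c x != c root.
  by apply: contra xr => /eqP cxr; apply/eqP/rank_inj; rewrite ?root_rank.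
case: (posnP (a y)) => ay0; last first.
  rewrite !exp0n // !muln0; case: eqP => // yx.
  by rewrite yx ax in ay0.
rewrite ay0 !muln1.
have -> : c root == c y = false.
  by apply: contraNF yr => /eqP cyr; rewrite (rank_inj cyr) ?ay0.
have -> : (c x == c y) = (y == x); last by rewrite subr0; case: (y == x).
by apply/eqP/eqP => [cxy|-> //]; apply: rank_inj; rewrite ?ax.
Qed.

(** The total weight on the colour of a node of positive weight is a positive
    integer, hence all of the weight is on that colour. The weighted average of
    the ranks is then an integer between 0 and the largest rank of the class,
    hence the rank of some node of the class. *)
Lemma join_point_lattice n (u : 'I_n -> G) (w : 'I_n -> rat) v :
  (forall i, 0 <= w i) -> \sum_i w i = 1 ->
  int_point v = \sum_i w i *: int_point (f (u i)) -> exists x, f x = v.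
Proof.
move=> w0 w1 vE.
have [i0 wi0] : exists i, 0 < w i.
  have [|i /andP[_ wi]] := @psumr_neq0P _ _ xpredT w (fun i _ => w0 i).
    by rewrite w1; apply/eqP/oner_neq0.
  by exists i.
set q := u i0.
(* All the weight lies on nodes of the colour of q. *)
have off i : w i * (c (u i) != c q)%:R = 0.
  have [m mE] := affine_on_nodes_int (same_color_affine q) w1 vE.
  have m1 : 1 <= m%:~R :> rat.
    have : 0 < m%:~R :> rat.
      rewrite -mE (bigD1 i0) //= eqxx mulr1 ltr_wpDr ?sumr_ge0 // => j _.
      by rewrite mulr_ge0.
    by rewrite ltr0z ler1z gtz0_ge1.
  apply: (@psumr_eq0P _ _ xpredT (fun i => w i * (c (u i) != c q)%:R)) => // [j _|].
    by rewrite mulr_ge0.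
  apply: le_anti; rewrite sumr_ge0 ?andbT => [|j _]; last by rewrite mulr_ge0.
  rewrite -(lerD2r m%:~R) add0r; apply: le_trans m1.
  rewrite -mE -big_split -[leRHS]w1; apply: ler_sum => j _ /=.
  have split_weight (b : bool) : w j * (~~ b)%:R + w j * b%:Z%:~R = w j.
    by case: b => /=; ring.
  by rewrite split_weight.
have supp i (F F' : rat) : (c (u i) = c q -> F = F') -> w i * F = w i * F'.
  move=> FF; have := off i; case: eqP => [/FF->//|_].
  by rewrite mulr1 => ->; rewrite !mul0r.
have [m mE] := affine_on_nodes_int (rank_affine q) w1 vE.
have m_ge0 : 0 <= m.
  by rewrite -(ler0z rat) -mE sumr_ge0 // => i _; rewrite mulr_ge0 // ler0z.
have m_lt : (`|m| < size (color_class (c q)))%N.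
  have s_gt0 := leq_ltn_trans (leq0n _) (rank_lt q).
  rewrite -(prednK s_gt0) ltnS -lez_nat gez0_abs // -(ler_int rat) -mE.
  rewrite -[leRHS]mul1r -[X in _ <= X * _]w1 mulr_suml; apply: ler_sum => i _.
  rewrite ler_wpM2l // ler_int lez_nat; case: eqP => // cuq.
  by rewrite mul1n -ltnS prednK // -cuq rank_lt.
have [y cy ay] := rank_surj m_lt.
exists y; apply/rowP => j; apply: (@intr_inj rat).
move/rowP/(_ j): vE; rewrite [LHS]mxE summxE => ->.
rewrite [in LHS]mxE; set x := enum_val j.
under eq_bigr => i _.
  rewrite !mxE -/x (supp i _ ((c q == c x) * a (u i) ^ a x)%N%:~R); last first.
    by rewrite /pivot_coord => ->.
  over.
rewrite /pivot_coord cy; case: (c q == c x); last first.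
  by rewrite mul0n big1 // => i _; rewrite mulr0.
rewrite mul1n ay.
have : x \in pivots := enum_valP j; rewrite inE => /andP[ax _].
move: (a x) ax => [|[|//]] _.
  by rewrite expn0 -[LHS]w1; apply: eq_bigr => i _; rewrite mulr1.
rewrite expn1 gez0_abs // -mE; apply: eq_bigr => i _.
by apply: supp => ->; rewrite eqxx.
Qed.

Lemma join_realizable : fiber_realizable G #|pivots|.
Proof.
apply: (realizable_of_embedding (f := f) root).
- by move=> u j; rewrite mxE.
- exact: join_point_inj.
- exact: join_point_lattice.
- exact: join_point_span.
- by move=> x y x' y' l /c_proper; exact: join_point_diff.
Qed.

End SegmentJoin.

Lemma realizable_of_coloring (G : sgraph) k (c : G -> 'I_k) :
  (0 < #|G|)%N -> (forall x y, edge x y -> c x != c y) ->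
  exists2 d, fiber_realizable G d & (d < 2 * k)%N.
Proof.
move=> /card_gt0P[x _] c_proper.
have [root _ root0] : exists2 r, c r = c x & rank_in_class c r = 0%N.
  by apply: rank_surj; apply: leq_trans (rank_lt c x).
exists #|pivots c root|; [exact: join_realizable | exact: card_pivots].
Qed.

Theorem corollary3p6 (G : sgraph) (G_nonempty : (0 < #|G|)%N) :
  exists d : nat,
    is_fdim G d /\ (d%:Z <= 2%:Z * (chromatic_number G)%:Z - 1%:Z)%R.
Proof.
rewrite /chromatic_number; case: ex_minnP => k /existsP[c c_proper] _.
have [|d0 real0 d0k] := @realizable_of_coloring G k c G_nonempty.
  by move=> x y xy; have /forallP/(_ x)/forallP/(_ y)/implyP/(_ xy) := c_proper.
have ex_d : exists d, `[<fiber_realizable G d>] by exists d0; apply/asboolP.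
case: (ex_minnP ex_d) => d /asboolP real_d d_min; exists d.
have min d' : fiber_realizable G d' -> (d <= d')%N by move=> ?; apply/d_min/asboolP.
by split; [split|have := min _ real0; lia].
Qed.
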